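(* Let $\mathbb{F}=\mathbb{C}\times\mathbb{C}$ with involution $(a,b)^*=(\overline a,\overline b)$, and let $\mathbb{F}^2$ carry the Hermitian form $\langle u,v\rangle=-u_1v_1^*+u_2v_2^*$. The map $$\Lambda:\mathbb{P}^1_{\mathbb{F}}\to\mathbb{P}^1_{\mathbb{C}}\times\mathbb{P}^1_{\mathbb{C}},\qquad[(a_1,b_1):(a_2,b_2)]\mapsto([a_1:a_2],[b_1:b_2]),$$ is a diffeomorphism, and it restricts to an isometry from $(\mathbb{B}^4,g_{\mathbb{B}^4})$ onto the hyperbolic bidisc $\mathbb{H}^1_{\mathbb{C}}\times\mathbb{H}^1_{\mathbb{C}}$ with the Riemannian product metric. Moreover, the map $\big((a_{ij},b_{ij})\big)\mapsto\big((a_{ij}),(b_{ij})\big)$ is a group isomorphism $\mathrm{U}(\mathbb{F}^2,\langle\cdot,\cdot\rangle)\to\mathrm{U}(1,1)\times\mathrm{U}(1,1)$, under which the action of $\mathrm{U}(\mathbb{F}^2,\langle\cdot,\cdot\rangle)$ on $\mathbb{B}^4$ corresponds via $\Lambda$ to the action of $\mathrm{U}(1,1)\times\mathrm{U}(1,1)$ on $\mathbb{H}^1_{\mathbb{C}}\times\mathbb{H}^1_{\mathbb{C}}$; likewise $\mathrm{SU}(\mathbb{F}^2,\langle\cdot,\cdot\rangle)\simeq\mathrm{SU}(1,1)\times\mathrm{SU}(1,1)$ and $\mathrm{PU}(\mathbb{F}^2,\langle\cdot,\cdot\rangle)\simeq\mathrm{PU}(1,1)\times\mathrm{PU}(1,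1)$.
   Context: $\mathbb{F}=\mathbb{C}\times\mathbb{C}$ has coordinatewise operations; its self-adjoint elements form $\mathbb{R}\times\mathbb{R}$. A vector $u\in\mathbb{F}^2$ is good if $u_1\mathbb{F}+u_2\mathbb{F}=\mathbb{F}$, and $\mathbb{P}^1_{\mathbb{F}}$ is the set of good vectors modulo the units $\mathbb{F}^\times$, with its quotient smooth structure. For $u=((a_1,b_1),(a_2,b_2))$ one has $\langle u,u\rangle=(-|a_1|^2+|a_2|^2,-|b_1|^2+|b_2|^2)$. Put $\mathbb{B}^4=\{[u]\in\mathbb{P}^1_{\mathbb{F}}:\langle u,u\rangle\in\mathbb{R}_{<0}\times\mathbb{R}_{<0}\}$. The tangent space at $[p]\in\mathbb{B}^4$ is identified with the $\mathbb{F}$-linear maps $t:\mathbb{F}p\to p^\perp$, $p^\perp=\{v:\langle v,p\rangle=0\}$ ($t$ is the velocity at $\epsilon=0$ of $\epsilon\mapsto[p+\epsilon t(p)]$, $\epsilon$ real). The $\mathbb{F}$-valued Hermitian metric is $\langle t,t'\rangle=-\frac{\langle t(p),t'(p)\rangle}{\langle p,p\rangle}$, and the Riemannian metric $g_{\mathbb{B}^4}(t,t')$ is obtained by taking its real part $\mathrm{Re}\,w=(w+w^* )/2\in\mathbb{R}\times\mathbb{R}$ and summing the two coordinates. On $\mathbb{C}^2$ take the Hermitian form $\langle x,y\rangle=-x_1\overline{y_1}+x_2\overline{y_2}$; $\mathbb{H}^1_{\mathbb{C}}=\{[p]\in\mathbb{P}^1_{\mathbb{C}}:\langle p,p\rangle<0\}$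 with Riemannian metric $g(\phi,\psi)=-\mathrm{Re}\frac{\langle\phi(p),\psi(p)\rangle}{\langle p,p\rangle}$ for $\phi,\psi\in\mathrm{Lin}_{\mathbb{C}}(\mathbb{C}p,p^\perp)=T_{[p]}\mathbb{P}^1_{\mathbb{C}}$. $\mathrm{U}(1,1)$ is the unitary group of this form, $\mathrm{SU}(1,1)$ its subgroup of determinant one, $\mathrm{PU}(1,1)$ its quotient by scalars. $\mathrm{U}(\mathbb{F}^2,\langle\cdot,\cdot\rangle)$ is the group of $\mathbb{F}$-linear $T:\mathbb{F}^2\to\mathbb{F}^2$ with $\langle T(u),T(v)\rangle=\langle u,v\rangle$, written as $2\times2$ matrices with entries $(a_{ij},b_{ij})\in\mathbb{F}$; $\mathrm{SU}$ is the subgroup of determinant $1\in\mathbb{F}$, and $\mathrm{PU}$ the quotient of $\mathrm{U}$ by its scalar matrices. *)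

(* Defs.v *)
From HB Require Import structures.
From mathcomp Require Import all_boot all_order all_algebra.
From mathcomp Require Import complex ring.
From mathcomp Require Import all_classical all_reals all_analysis.

Set Implicit Arguments.
Unset Strict Implicit.
Unset Printing Implicit Defensive.

Import Order.TTheory GRing.Theory Num.Theory numFieldNormedType.Exports.
Local Open Scope classical_set_scope.
Local Open Scope ring_scope.
Local Open Scope complex_scope.

(* R[i] with the topology given by its modulus, as the analysis library does
   for abstract numFieldTypes *)
#[export, non_forgetful_inheritance]
HB.instance Definition _ (R : realType) := NormedModule.copy R[i] R[i]^o.


HB.mixin Record isInvolutive A of GRing.ComUnitRing A := {
  invol : A -> A;
  involK : involutive invol;
  involD : {morph invol : a b / a + b};
  involM : {morph invol : a b / a * b}
}.

#[short(type="involRingType")]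
HB.structure Definition InvolRing := {A of isInvolutive A & GRing.ComUnitRing A}.

Section ComplexInvol.
Variable R : realType.
Lemma conjc_involK : involutive (@conjc R). Proof. exact: conjcK. Qed.
Lemma conjc_involD : {morph (@conjc R) : a b / a + b}.
Proof. exact: raddfD. Qed.
Lemma conjc_involM : {morph (@conjc R) : a b / a * b}.
Proof. exact: rmorphM. Qed.
HB.instance Definition _ :=
  isInvolutive.Build R[i] conjc_involK conjc_involD conjc_involM.
End ComplexInvol.

Section PairInvol.
Variables A B : involRingType.
Definition pair_invol (w : A * B) : A * B := (invol w.1, invol w.2).
Lemma pair_involK : involutive pair_invol.
Proof. by case=> a b; rewrite /pair_invol /= !involK. Qed.
Lemma pair_involD : {morph pair_invol : a b / a + b}.
Proof. by case=> a b [c d]; rewrite /pair_invol /= !involD. Qed.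
Lemma pair_involM : {morph pair_invol : a b / a * b}.
Proof. by case=> a b [c d]; rewrite /pair_invol /= !involM. Qed.
HB.instance Definition _ :=
  isInvolutive.Build (A * B)%type pair_involK pair_involD pair_involM.
End PairInvol.

Section Projective.
Variable A : involRingType.
Implicit Types (a b c : A) (u v w : A * A) (T : 'M[A]_2).

Definition scalv a u : A * A := (a * u.1, a * u.2).

Definition herm u v : A := - (u.1 * invol v.1) + u.2 * invol v.2.

(* u.1 A + u.2 A = A; see good_complexE for A = R[i] *)
Definition good u : Prop := forall c, exists x y, u.1 * x + u.2 * y = c.

Definition mxact T u : A * A :=
  (T ord0 ord0 * u.1 + T ord0 ord_max * u.2,
   T ord_max ord0 * u.1 + T ord_max ord_max * u.2).

Lemma scalvA a b u : scalv a (scalv b u) = scalv (a * b) u.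
Proof. by rewrite /scalv /= !mulrA. Qed.

Lemma scal1v u : scalv 1 u = u.
Proof. by case: u => x y; rewrite /scalv /= !mul1r. Qed.

Lemma mxact_scalv T a u : mxact T (scalv a u) = scalv a (mxact T u).
Proof. by rewrite /mxact /scalv /=; congr (_, _); ring. Qed.

Lemma mxactM S T u : mxact (S *m T) u = mxact S (mxact T u).
Proof.
have o2 : lift ord0 ord0 = ord_max :> 'I_2 by apply/val_inj.
rewrite /mxact !mxE !big_ord_recl !big_ord0 /= !o2.
by congr (_, _); ring.
Qed.

Lemma mxact1 u : mxact 1%:M u = u.
Proof.
by case: u => x y; rewrite /mxact !mxE /= !mul1r !mul0r addr0 add0r.
Qed.

Lemma good10 : good (1, 0).
Proof. by move=> c; exists c, 0 => /=; rewrite mul1r mul0r addr0. Qed.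

Lemma good_unit u x y : u.1 * x + u.2 * y = 1 -> good u.
Proof.
by move=> h c; exists (x * c), (y * c); rewrite !mulrA -mulrDl h mul1r.
Qed.

Definition goodVec : Type := {u : A * A | `[< good u >]}.
HB.instance Definition _ := Choice.on goodVec.

Definition proportional (p q : goodVec) : bool :=
  `[< exists2 c, c \is a GRing.unit & val q = scalv c (val p) >].

Lemma proportional_refl : reflexive proportional.
Proof. by move=> u; apply/asboolP; exists 1; rewrite ?unitr1 ?scal1v. Qed.

Lemma proportional_sym : symmetric proportional.
Proof.
have S (p q : goodVec) : proportional p q -> proportional q p.
  move=> /asboolP[c cU E]; apply/asboolP; exists c^-1; first by rewrite unitrV.
  by rewrite E scalvA mulVr ?scal1v.
by move=> u v; apply/idP/idP; apply: S.
Qed.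

Lemma proportional_trans : transitive proportional.
Proof.
move=> v u w /asboolP[c cU E] /asboolP[d dU F]; apply/asboolP.
by exists (d * c); [rewrite unitrM dU|rewrite F E scalvA].
Qed.

Canonical proportional_equiv :=
  EquivRel proportional proportional_refl proportional_sym proportional_trans.

Definition P1 : Type := {eq_quot proportional}%qT.
HB.instance Definition _ := Choice.on P1.
HB.instance Definition _ := EqQuotient.on P1.

(* the class [u]; vectors that are not good are sent to the junk value [1 : 0] *)
Definition cls u : P1 :=
  \pi_(P1)%qT (insubd (exist _ (1, 0) (asboolT good10) : goodVec) u).

Definition rep (x : P1) : A * A := val (repr x).

Lemma rep_good x : good (rep x).
Proof. by rewrite /rep; case: (repr x) => u /= /asboolP. Qed.

Lemma repK : cancel rep cls.
Proof. by move=> x; rewrite /cls /rep valKd reprK. Qed.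

Lemma cls_eqP u v : good u -> good v ->
  cls u = cls v <-> exists2 c, c \is a GRing.unit & v = scalv c u.
Proof.
move=> gu gv; rewrite /cls; split.
- move=> /eqmodP /asboolP; rewrite !insubdK //; exact/asboolP.
- by move=> h; apply/eqmodP/asboolP; rewrite !insubdK //; exact/asboolP.
Qed.

Lemma rep_cls u : good u ->
  exists2 c, c \is a GRing.unit & rep (cls u) = scalv c u.
Proof.
by move=> gu; apply/(cls_eqP gu (rep_good _)); rewrite repK.
Qed.

(* see actE for the independence of the representative *)
Definition act T (x : P1) : P1 := cls (mxact T (rep x)).

Lemma good_mxact T u : T \in unitmx -> good u -> good (mxact T u).
Proof.
move=> TU gu; have [x [y h]] := gu 1.
have E : u = mxact (invmx T) (mxact T u) by rewrite -mxactM mulVmx // mxact1.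
have {h} : (mxact (invmx T) (mxact T u)).1 * x +
           (mxact (invmx T) (mxact T u)).2 * y = 1 by rewrite -E.
move: (mxact T u) (invmx T) => {E} v S h.
apply: (@good_unit _ (S ord0 ord0 * x + S ord_max ord0 * y)
                     (S ord0 ord_max * x + S ord_max ord_max * y)).
by rewrite -h /mxact /=; ring.
Qed.

Lemma actE T u : T \in unitmx -> good u -> act T (cls u) = cls (mxact T u).
Proof.
move=> TU gu; have [c cU E] := rep_cls gu.
have gc : good (rep (cls u)) by exact: rep_good.
rewrite /act; symmetry; apply/cls_eqP; try exact: good_mxact.
by exists c => //; rewrite E mxact_scalv.
Qed.

(* The line A p, and T_[p] = Lin_A(A p, p^perp); t is linear on the submodule
   A p, which is expressed on the underlying vectors. *)
Definition line p : set (A * A) := [set scalv a p | a in setT].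

Lemma line_self p : line p p.
Proof. by exists 1; rewrite ?scal1v. Qed.

Record tangent p := Tangent {
  tan_fun :> {x | line p x} -> A * A;
  tan_linear : forall a b (x y z : {x | line p x}),
    sval z = scalv a (sval x) + scalv b (sval y) ->
    tan_fun z = scalv a (tan_fun x) + scalv b (tan_fun y);
  tan_perp : forall x, herm (tan_fun x) p = 0
}.

Definition at_base p (t : tangent p) : A * A := t (exist _ p (line_self p)).

Definition hmetric p (t t' : tangent p) : A :=
  - (herm (at_base t) (at_base t') / herm p p).

End Projective.

Lemma good_complexE (R : realType) (u : R[i] * R[i]) : good u <-> u != 0.
Proof.
split=> [gu|]; first apply/eqP => u0.
  have [x [y]] := gu 1; rewrite u0 !mul0r addr0 => /esym/eqP.
  by rewrite oner_eq0.
case: u => a b; rewrite xpair_eqE negb_and => /orP[] n0.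
  by apply: (@good_unit _ _ a^-1 0) => /=; rewrite mulr0 addr0 divff.
by apply: (@good_unit _ _ 0 b^-1) => /=; rewrite mulr0 add0r divff.
Qed.

Section UnitaryGroup.
Variable A : involRingType.
Implicit Types (u v w : A * A) (S T : 'M[A]_2).

Definition unitary T : bool :=
  `[< forall u v, herm (mxact T u) (mxact T v) = herm u v >].

Lemma invol0 : invol 0 = 0 :> A.
Proof. by apply: (@addrI _ (invol 0)); rewrite -involD !addr0. Qed.

Lemma invol1 : invol 1 = 1 :> A.
Proof. by rewrite -[LHS]mulr1 -{2}(involK 1) -involM mul1r involK. Qed.

Lemma unitary_unitmx T : unitary T -> T \in unitmx.
Proof.
move=> /asboolP h.
have h00 := h (1, 0) (1, 0); have h01 := h (1, 0) (0, 1).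
have h10 := h (0, 1) (1, 0); have h11 := h (0, 1) (0, 1).
move: h00 h01 h10 h11.
rewrite /herm /mxact /= !mulr1 !mulr0 !addr0 !add0r invol0 invol1.
rewrite !mulr1 !mulr0 oppr0 !addr0 ?add0r.
set a := T ord0 ord0; set b := T ord0 ord_max.
set c := T ord_max ord0; set d := T ord_max ord_max.
move=> h00 h01 h10 h11.
pose S : 'M[A]_2 := \matrix_(i, j)
  if i == ord0 then if j == ord0 then invol a else - invol c
  else if j == ord0 then - invol b else invol d.
suff /mulmx1_unit[] : S *m T = 1%:M by [].
have o2 : lift ord0 ord0 = ord_max :> 'I_2 by apply/val_inj.
have I2 (i : 'I_2) : i = ord0 \/ i = ord_max.
  by case: i => [[|[|k]] hk] //; [left|right]; apply/val_inj.
apply/matrixP => i j; rewrite !mxE !big_ord_recl big_ord0 !mxE /= o2.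
case: (I2 i) => ->; case: (I2 j) => -> /=; rewrite -/a -/b -/c -/d.
- by rewrite -[RHS]opprK -[in RHS]h00; ring.
- by rewrite -[RHS]oppr0 -[in RHS]h10; ring.
- by rewrite -[RHS]h01; ring.
- by rewrite -[RHS]h11; ring.
Qed.

Lemma unitary1 : unitary 1%:M.
Proof. by apply/asboolP => u v; rewrite !mxact1. Qed.

Lemma unitaryM S T : unitary S -> unitary T -> unitary (S *m T).
Proof.
by move=> /asboolP hS /asboolP hT; apply/asboolP => u v; rewrite !mxactM hS.
Qed.

Lemma unitaryV T : unitary T -> unitary (invmx T).
Proof.
move=> TU; have Tu := unitary_unitmx TU; apply/asboolP => u v.
by have /asboolP <- := TU; rewrite -!mxactM mulmxV // !mxact1.
Qed.

Record U := MkU { mx_of_U :> 'M[A]_2; U_unitary : unitary mx_of_U }.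
HB.instance Definition _ := [isSub for mx_of_U].
HB.instance Definition _ := [Choice of U by <:].

Definition U_one := MkU unitary1.
Definition U_mul (S T : U) := MkU (unitaryM (U_unitary S) (U_unitary T)).
Definition U_inv (T : U) := MkU (unitaryV (U_unitary T)).

Lemma U_mulA : associative U_mul.
Proof. by move=> S T V; apply/val_inj; rewrite /= mulmxA. Qed.
Lemma U_mul1 : left_id U_one U_mul.
Proof. by move=> T; apply/val_inj; rewrite /= mul1mx. Qed.
Lemma U_mulr1 : right_id U_one U_mul.
Proof. by move=> T; apply/val_inj; rewrite /= mulmx1. Qed.
Lemma U_mulV : left_inverse U_one U_inv U_mul.
Proof.
by move=> T; apply/val_inj; rewrite /= mulVmx // unitary_unitmx ?U_unitary.
Qed.
Lemma U_mulrV : right_inverse U_one U_inv U_mul.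
Proof.
by move=> T; apply/val_inj; rewrite /= mulmxV // unitary_unitmx ?U_unitary.
Qed.
HB.instance Definition _ :=
  isGroup.Build U U_mulA U_mul1 U_mulr1 U_mulV U_mulrV.

End UnitaryGroup.

Section SpecialProjective.
Variable A : involRingType.
Local Notation U := (U A).
Implicit Types (S T V Y Z : U).

Definition special : {pred U} := fun T => \det T == 1.

Lemma special_closed : group_closed special.
Proof.
split; first by rewrite unfold_in /= det1.
move=> S T; rewrite !unfold_in /= det_mulmx det_inv => /eqP -> /eqP ->.
by rewrite invr1 mulr1.
Qed.

Record SU := MkSU { U_of_SU :> U; SU_special : special U_of_SU }.
HB.instance Definition _ := [isSub for U_of_SU].
HB.instance Definition _ := [Choice of SU by <:].
HB.instance Definition _ := SubChoice_isSubGroup.Build U special SU special_closed.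

Local Open Scope group_scope.

Definition eq_mod_scalar (S T : U) : bool :=
  `[< exists2 Z : U, is_scalar_mx Z & S = Z * T >].

Lemma is_scalar_mxM (Y Z : U) :
  is_scalar_mx Y -> is_scalar_mx Z -> is_scalar_mx (Y * Z)%g.
Proof.
move=> /is_scalar_mxP[a Ea] /is_scalar_mxP[b Eb]; apply/is_scalar_mxP.
by exists (a * b)%R; rewrite /= Ea Eb -scalar_mxM.
Qed.

Lemma is_scalar_mxV (Z : U) : is_scalar_mx Z -> is_scalar_mx Z^-1%g.
Proof.
move=> /is_scalar_mxP[a Ea]; apply/is_scalar_mxP; exists a^-1%R.
by rewrite /= Ea invmx_scalar.
Qed.

Lemma scalar_central (Z T : U) : is_scalar_mx Z -> Z * T = T * Z.
Proof.
move=> /is_scalar_mxP[a Ea]; apply/val_inj; rewrite /= Ea.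
by rewrite scalar_mxC.
Qed.

Lemma eq_mod_scalar_refl : reflexive eq_mod_scalar.
Proof.
move=> T; apply/asboolP; exists 1; last by rewrite mul1g.
by apply/is_scalar_mxP; exists 1%R.
Qed.

Lemma eq_mod_scalar_sym : symmetric eq_mod_scalar.
Proof.
have E S T : eq_mod_scalar S T -> eq_mod_scalar T S.
  move=> /asboolP[Z Zs ->]; apply/asboolP; exists Z^-1.
    exact: is_scalar_mxV.
  by rewrite mulKg.
by move=> S T; apply/idP/idP; apply: E.
Qed.

Lemma eq_mod_scalar_trans : transitive eq_mod_scalar.
Proof.
move=> T S V /asboolP[Y Ys ->] /asboolP[Z Zs ->]; apply/asboolP.
by exists (Y * Z); [exact: is_scalar_mxM|rewrite mulgA].
Qed.

Canonical eq_mod_scalar_equiv := EquivRel eq_mod_scalar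
  eq_mod_scalar_refl eq_mod_scalar_sym eq_mod_scalar_trans.

Definition PU : Type := {eq_quot eq_mod_scalar}%qT.
HB.instance Definition _ := Choice.on PU.
HB.instance Definition _ := EqQuotient.on PU.

Definition PU_of (T : U) : PU := \pi_(PU)%qT T.

Definition PU_one := PU_of 1.
Definition PU_mul (x y : PU) := PU_of (repr x * repr y).
Definition PU_inv (x : PU) := PU_of (repr x)^-1.

Lemma repr_PU_of T : exists2 Z : U, is_scalar_mx Z & repr (PU_of T) = Z * T.
Proof.
have : PU_of (repr (PU_of T)) = PU_of T by rewrite /PU_of reprK.
by move=> /eqmodP /asboolP.
Qed.

Lemma PU_ofM S T : PU_mul (PU_of S) (PU_of T) = PU_of (S * T).
Proof.
have [Y Ys EY] := repr_PU_of S; have [Z Zs EZ] := repr_PU_of T.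
rewrite /PU_mul EY EZ; apply/eqmodP/asboolP; exists (Y * Z).
  exact: is_scalar_mxM.
by rewrite -!mulgA; congr (_ * _); rewrite !mulgA (scalar_central S Zs).
Qed.

Lemma PU_ofV T : PU_inv (PU_of T) = PU_of T^-1.
Proof.
have [Z Zs EZ] := repr_PU_of T; rewrite /PU_inv EZ; apply/eqmodP/asboolP.
exists Z^-1; first exact: is_scalar_mxV.
by rewrite invgM -(scalar_central _ (is_scalar_mxV Zs)).
Qed.

Lemma PU_ofP (x : PU) : PU_of (repr x) = x. Proof. exact: reprK. Qed.

Lemma PU_mulA : associative PU_mul.
Proof.
move=> x y z; rewrite -(PU_ofP x) -(PU_ofP y) -(PU_ofP z).
by rewrite !PU_ofM mulgA.
Qed.
Lemma PU_mul1 : left_id PU_one PU_mul.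
Proof. by move=> x; rewrite -(PU_ofP x) PU_ofM mul1g. Qed.
Lemma PU_mulr1 : right_id PU_one PU_mul.
Proof. by move=> x; rewrite -(PU_ofP x) PU_ofM mulg1. Qed.
Lemma PU_mulV : left_inverse PU_one PU_inv PU_mul.
Proof. by move=> x; rewrite -(PU_ofP x) PU_ofV PU_ofM mulVg. Qed.
Lemma PU_mulrV : right_inverse PU_one PU_inv PU_mul.
Proof. by move=> x; rewrite -(PU_ofP x) PU_ofV PU_ofM mulgV. Qed.
HB.instance Definition _ :=
  isGroup.Build PU PU_mulA PU_mul1 PU_mulr1 PU_mulV PU_mulrV.

End SpecialProjective.

Section Smooth.
Variable R : realType.

(* C^n and C^infinity for real-valued functions on open subsets of a
   finite-dimensional complex normed space V regarded as a real one: all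
   iterated directional derivatives, along real multiples of vectors of V,
   exist and are continuous. *)
Definition rline (V : normedModType R[i]) (x v : V) (e : R) : V :=
  x + e%:C *: v.

Definition dird (V : normedModType R[i]) (h : V -> R) (v x : V) : R :=
  'D_1 (h \o rline x v) 0.

Fixpoint Cn_on (n : nat) (V : normedModType R[i]) (O : set V) (h : V -> R)
    : Prop :=
  (forall x, O x -> {for x, continuous h}) /\
  if n is m.+1 then
    forall v, (forall x, O x -> derivable (h \o rline x v) 0 1) /\
              Cn_on m O (dird h v)
  else True.

Definition smooth_on (V : normedModType R[i]) (O : set V) (h : V -> R) : Prop :=
  forall n, Cn_on n O h.

(* A manifold given as a quotient: sq_proj restricts to a surjective
   submersion from the open subset sq_dom of sq_total (its values elsewhere
   are junk). The topology and the sheaf of smooth functions are the quotient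
   ones: W is open, resp. h : W -> R is smooth, iff its pullback to sq_dom is.
   A map is smooth iff it is continuous and pulls back smooth functions on
   open sets to smooth functions. *)
Record smoothQuotient := SmoothQuotient {
  sq_total : normedModType R[i];
  sq_dom : set sq_total;
  sq_point :> Type;
  sq_proj : sq_total -> sq_point
}.

Definition sq_preimage (M : smoothQuotient) (W : set M) : set (sq_total M) :=
  @sq_dom M `&` @sq_proj M @^-1` W.

Definition mopen (M : smoothQuotient) (W : set M) : Prop :=
  open (sq_preimage W).

Definition msmooth (M : smoothQuotient) (W : set M) (h : M -> R) : Prop :=
  smooth_on (sq_preimage W) (h \o @sq_proj M).

Definition smooth_map (M N : smoothQuotient) (f : M -> N) : Prop :=
  forall W : set N, mopen W -> mopen (f @^-1` W) /\
    forall h : N -> R, msmooth W h -> msmooth (f @^-1` W) (h \o f).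

Definition diffeomorphism (M N : smoothQuotient) (f : M -> N) : Prop :=
  exists g : N -> M,
    [/\ cancel f g, cancel g f, smooth_map f & smooth_map g].

(* A product of two surjective submersions is a surjective submersion onto the
   product manifold, hence determines its smooth structure. *)
Definition prodM (M N : smoothQuotient) : smoothQuotient :=
  @SmoothQuotient (sq_total M * sq_total N)%type (@sq_dom M `*` @sq_dom N)
    (M * N)%type (fun u => (sq_proj u.1, sq_proj u.2)).

(* The curves c and c' pass through the same point at time 0 with the same
   velocity. *)
Definition same_velocity (M : smoothQuotient) (c c' : R -> M) : Prop :=
  c 0 = c' 0 /\
  forall (W : set M) (h : M -> R), mopen W -> W (c 0) -> msmooth W h ->
    exists d : R, is_derive (0 : R) 1 (h \o c) d /\
                  is_derive (0 : R) 1 (h \o c') d.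

End Smooth.

Section Bidisc.
Variable R : realType.
Local Notation C := R[i].
Local Notation F := (R[i] * R[i])%type.

Definition P1C : smoothQuotient R :=
  @SmoothQuotient R (C * C)%type (@good C) (P1 C) (@cls C).
Definition P1F : smoothQuotient R :=
  @SmoothQuotient R (F * F)%type (@good F) (P1 F) (@cls F).

Definition fstv (u : F * F) : C * C := (u.1.1, u.2.1).
Definition sndv (u : F * F) : C * C := (u.1.2, u.2.2).

(* see LambdaE for the independence of the representative *)
Definition Lambda (x : P1F) : prodM P1C P1C :=
  (cls (fstv (rep x)), cls (sndv (rep x))).

Lemma good_fstv u : good u -> good (fstv u).
Proof.
move=> gu; have [x [y h]] := gu 1.
by apply: (@good_unit _ _ x.1 y.1); exact: (congr1 fst h).
Qed.

Lemma good_sndv u : good u -> good (sndv u).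
Proof.
move=> gu; have [x [y h]] := gu 1.
by apply: (@good_unit _ _ x.2 y.2); exact: (congr1 snd h).
Qed.

Lemma LambdaE u : good u -> Lambda (cls u) = (cls (fstv u), cls (sndv u)).
Proof.
move=> gu; have [c cU E] := rep_cls gu; have gr := rep_good (cls u).
have [c1 c2] : c.1 \is a GRing.unit /\ c.2 \is a GRing.unit.
  by move: cU; rewrite -[_ \is a _]/(_ && _) => /andP[].
by rewrite /Lambda; congr (_, _); symmetry; apply/cls_eqP;
  rewrite ?E; do ?[exact: good_fstv|exact: good_sndv|
  by rewrite -E; exact: good_fstv|by rewrite -E; exact: good_sndv];
  [exists c.1|exists c.2].
Qed.

(* In R[i], z < 0 means that z is a negative real. *)
Definition negC (u : C * C) : Prop := herm u u < 0.
Definition negF (u : F * F) : Prop := (herm u u).1 < 0 /\ (herm u u).2 < 0.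

Definition H1C : set P1C := [set cls u | u in [set u | good u /\ negC u]].
Definition B4 : set P1F := [set cls u | u in [set u | good u /\ negF u]].

Definition gH1C (p : C * C) (t t' : tangent p) : R := complex.Re (hmetric t t').

(* (w + w^* ) / 2 lies in R x R; its two coordinates are summed *)
Definition gB4 (p : F * F) (t t' : tangent p) : R :=
  complex.Re (hmetric t t').1 + complex.Re (hmetric t t').2.

Definition gprod (q1 q2 : C * C) (s s' : tangent q1 * tangent q2) : R :=
  gH1C s.1 s'.1 + gH1C s.2 s'.2.

(* the curves e |-> [p + e t(p)] whose velocities at 0 are identified with t *)
Definition curveC (p : C * C) (t : tangent p) (e : R) : P1C :=
  cls (rline p (at_base t) e).
Definition curveF (p : F * F) (t : tangent p) (e : R) : P1F :=
  cls (rline p (at_base t) e).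

(* s is the image of t under the differential of Lambda at [p], for
   representatives q1, q2 of the components of Lambda [p] *)
Definition dLambda (p : F * F) (q1 q2 : C * C) (t : tangent p)
    (s : tangent q1 * tangent q2) : Prop :=
  same_velocity (M := prodM P1C P1C) (Lambda \o curveF t)
    (fun e => (curveC s.1 e, curveC s.2 e)).

End Bidisc.

(* Main.v *)
Require Import Defs.
From HB Require Import structures.
From mathcomp Require Import all_boot all_order all_algebra.
From mathcomp Require Import complex ring.
From mathcomp Require Import all_classical all_reals all_analysis.

Set Implicit Arguments.
Unset Strict Implicit.
Unset Printing Implicit Defensive.

Import Order.TTheory GRing.Theory Num.Theory numFieldNormedType.Exports.
Local Open Scope classical_set_scope.
Local Open Scope ring_scope.
Local Open Scope complex_scope.

(** The ring [F] is the product of two copies of [C], and every notion involved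
    (the Hermitian form, goodness, units, unitarity, determinant, scalar matrices)
    decomposes along the two factors.

    At the level of total spaces [Lambda] is covered by the linear homeomorphism
    [split_comp], which only permutes the four complex coordinates.  Since open
    sets and smooth functions on the quotients are defined by pullback, this gives
    the diffeomorphism ([smooth_map_lift], [Lambda_diffeo]).

    For the isometry, let [q1 = c1 p1] and [q2 = c2 p2], where [p1], [p2] are the
    components of [p].  [Lambda] carries the curve [p + e t(p)] to the class of the
    pair of lines [q1 + e c1 t(p)_1], [q2 + e c2 t(p)_2] ([Lambda_curve]), so the
    differential sends [t] to the tangent vectors with these directions, and the
    factors [c1], [c2] cancel in the metric ([dLambda_isometry]).  The
    substantial point is that a velocity determines its direction
    ([velocity_inj]).  Directions orthogonal to [q] are separated by the
    functions [Re (herm u w / herm u q)], which descend to the quotient, are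
    smooth because they are rational ([ratfun_smooth]), and are affine along the
    lines considered ([coordinate_rline]).

    The group isomorphisms come from separating the matrix entries
    ([unitary_split], [special_split]); for the projective groups one uses that
    a pair of scalar matrices is a scalar matrix over [F] ([PU_split_eq]). *)

(** * Smooth functions on quotient manifolds *)

Section RealSmoothness.
Variable R : realType.
Local Notation C := R[i].

Lemma real_contraction_continuous (k : {additive C -> R}) :
  (forall z, `|k z|%:C <= `|z|) -> continuous (k : C -> R).
Proof.
move=> k_le z; have F : Filter (nbhs z) by exact: nbhs_filter.
apply/cvgrPdist_lt => e e0; have e0' : 0 < e%:C :> C by rewrite ltcR.
have : nbhs z (fun w : C => `|z - w| < e%:C).
  exact: (@cvgr_dist_lt C C C (nbhs z) _ id z (@cvg_id _ _) _ e0').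
apply: filterS => w h.
by rewrite -raddfB -ltcR; exact: le_lt_trans (k_le _) h.
Qed.

Lemma Re_continuous : continuous (@complex.Re R : C -> R).
Proof. by apply: real_contraction_continuous; exact: normc_ge_Re. Qed.

Lemma Im_continuous : continuous (@complex.Im R : C -> R).
Proof.
apply: real_contraction_continuous => z.
by rewrite -normrN -ReiNIm (le_trans (normc_ge_Re _)) // normrM normCi mulr1.
Qed.

Section OnV.
Variable V : normedModType C.
Implicit Types (O : set V) (f g h : V -> R) (x v : V).

Lemma near_rline O x v : open O -> O x -> \forall e \near (0 : R), O (rline x v e).
Proof.
move=> oO Ox.
have : nbhs x O by exact: open_nbhs_nbhs.
move=> /nbhs_ballP[e /= e0 sub].
(* The norm of V takes values in C: the radius is a positive, hence real, complex
   number, and its real part is the radius in R.  Adding 1 covers v = 0. *)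
have d0 : 0 < `|v| + 1 by rewrite ltr_wpDl.
have q0 : 0 < e / (`|v| + 1) by rewrite divr_gt0.
have qR : e / (`|v| + 1) = (complex.Re (e / (`|v| + 1)))%:C.
  by rewrite RRe_real // gtr0_real.
have r0 : 0 < complex.Re (e / (`|v| + 1)) by rewrite -ltcR -qR.
apply/nbhs_ballP; exists (complex.Re (e / (`|v| + 1))) => //= y.
rewrite -ball_normE /= sub0r normrN => yr; apply: sub.
rewrite -ball_normE /= /rline opprD addrA subrr sub0r normrN normrZ.
have ny : `|y%:C| = `|y|%:C :> C by rewrite normc_def /= expr0n addr0 sqrtr_sqr.
have : `|y%:C| < e / (`|v| + 1) by rewrite qR ny ltcR.
rewrite ltr_pdivlMr // => H; apply: le_lt_trans H.
by rewrite ler_wpM2l // lerDl.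
Qed.

Lemma continuous_ext_near O f g x : open O -> (forall x, O x -> f x = g x) ->
  O x -> {for x, continuous f} -> {for x, continuous g}.
Proof.
move=> oO E Ox cf; rewrite /prop_for /continuous_at -(E x Ox).
apply: cvg_trans cf; apply: near_eq_cvg.
by apply: filterS (open_nbhs_nbhs (conj oO Ox)).
Qed.

(** Off [O] the values of a function pulled back from a quotient are junk, so
    every comparison of such functions is made on [O] only.  Openness makes this
    harmless: a directional derivative at a point of [O] only sees the germ. *)
Lemma Cn_on_ext n O f g : open O -> (forall x, O x -> f x = g x) ->
  Cn_on n O f -> Cn_on n O g.
Proof.
move=> oO; elim: n f g => [|n IH] f g E /= [cf df].
  by split=> // x Ox; apply: continuous_ext_near oO E Ox (cf x Ox).
split=> [x Ox|v]; first by apply: continuous_ext_near oO E Ox (cf x Ox).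
have [dv Cv] := df v.
have N x : O x -> \forall e \near (0 : R), (f \o rline x v) e = (g \o rline x v) e.
  by move=> Ox; apply: filterS (near_rline v oO Ox) => y /E.
split=> [x Ox|].
  by have [] := @near_eq_is_derive _ _ _ _ _ _ _ _ (N x Ox) (derivableP (dv x Ox)).
by apply: IH Cv => x Ox; apply: near_eq_derive; exact: N.
Qed.

(** Rational functions in real-linear coordinates whose denominators do not
    vanish on [O].  The class is closed under directional derivatives, so one
    induction gives derivatives of all orders. *)
Inductive ratfun O : (V -> R) -> Prop :=
| ratfun_cst a : ratfun O (fun=> a)
| ratfun_lin l : continuous l ->
    (forall x v e, l (rline x v e) = l x + e * l v) -> ratfun O l
| ratfun_add f g : ratfun O f -> ratfun O g -> ratfun O (fun x => f x + g x)
| ratfun_mul f g : ratfun O f -> ratfun O g -> ratfun O (fun x => f x * g x)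
| ratfun_inv f : ratfun O f -> (forall x, O x -> f x != 0) ->
    ratfun O (fun x => (f x)^-1).

Lemma ratfun_continuous O f : ratfun O f -> forall x, O x -> {for x, continuous f}.
Proof.
elim=> {f} [a|l cl _|f g _ IHf _ IHg|f g _ IHf _ IHg|f _ IHf nz] x Ox.
- exact: cst_continuous.
- exact: cl.
- apply: continuousD; [exact: IHf|exact: IHg].
- apply: continuousM; [exact: IHf|exact: IHg].
- apply: continuousV; [exact: nz|exact: IHf].
Qed.

Lemma rline0 x v : rline x v 0 = x.
Proof. by rewrite /rline scale0r addr0. Qed.

Lemma is_derive_affine (a b : R) : is_derive (0 : R) 1 (fun e => a + e * b) b.
Proof.
have h := is_deriveD (is_derive_cst (a : R) (0 : R) 1)
  (is_deriveM (is_derive_id (0 : R) 1) (is_derive_cst (b : R) (0 : R) 1)).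
by apply: (is_derive_eq h); rewrite scale0r !add0r scaler1.
Qed.

Lemma ratfun_derive O f v : ratfun O f -> exists2 f', ratfun O f' &
  forall x, O x -> is_derive (0 : R) 1 (f \o rline x v) (f' x).
Proof.
elim=> {f} [a|l cl ll|f g rf [f' rf' df] rg [g' rg' dg]
  |f g rf [f' rf' df] rg [g' rg' dg]|f rf [f' rf' df] nz].
- exists (fun=> 0) => [|x Ox]; [exact: ratfun_cst|exact: is_derive_cst].
- exists (fun=> l v) => [|x Ox]; first exact: ratfun_cst.
  have -> : l \o rline x v = fun e => l x + e * l v by apply/funext => e /=.
  exact: is_derive_affine.
- exists (fun x => f' x + g' x) => [|x Ox]; first exact: ratfun_add.
  by have := is_deriveD (df x Ox) (dg x Ox).
- exists (fun x => f x * g' x + g x * f' x) => [|x Ox].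
    by apply: ratfun_add; apply: ratfun_mul.
  by have := is_deriveM (df x Ox) (dg x Ox); rewrite /= rline0.
- exists (fun x => (- 1) * ((f x)^-1 * (f x)^-1) * f' x) => [|x Ox].
    apply: ratfun_mul => //; apply: ratfun_mul; first exact: ratfun_cst.
    by apply: ratfun_mul; apply: ratfun_inv.
  have nzx : (f \o rline x v) 0 != 0 by rewrite /= rline0 nz.
  apply: (is_derive_eq (is_deriveV nzx (df x Ox))).
  by rewrite /= rline0 expr2 invfM mulN1r.
Qed.

Lemma ratfun_smooth O f : open O -> ratfun O f -> smooth_on O f.
Proof.
move=> oO rf n; elim: n f rf => [|n IH] f rf.
  by split=> //; exact: ratfun_continuous.
split=> [|v]; first exact: ratfun_continuous.
have [f' rf' df] := ratfun_derive v rf; split=> [x Ox|].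
  by have [] := df x Ox.
apply: Cn_on_ext (IH f' rf') => // x Ox; symmetry; rewrite /dird.
by have [] := df x Ox.
Qed.

End OnV.

Lemma Cn_on_comp (V W : normedModType C) n (s : W -> V) (O : set V) (f : V -> R) :
  continuous s -> (forall x v e, s (rline x v e) = rline (s x) (s v) e) ->
  Cn_on n O f -> Cn_on n (s @^-1` O) (f \o s).
Proof.
move=> cs ls; have c (g : V -> R) x : {for s x, continuous g} -> {for x, continuous (g \o s)}.
  by move=> cg; exact: (continuous_comp (cs x) cg).
have L g x v : (g \o s) \o rline x v = g \o rline (s x) (s v) :> (R -> R).
  by apply/funext => e /=; rewrite ls.
elim: n f => [|n IH] f /= [cf df].
  by split=> // x Ox; apply/c/cf.
split=> [x Ox|v]; first by apply/c/cf.
have [dv Cv] := df (s v); split=> [x Ox|].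
  by rewrite L; exact: dv.
have -> : dird (f \o s) v = dird f (s v) \o s.
  by apply/funext => x /=; rewrite /dird L.
exact: IH.
Qed.

(** Quotient topologies and sheaves only see pullbacks, so a map covered by a
    real-linear continuous map of the total spaces is smooth, as soon as the
    cover also reflects the domains. *)
Lemma smooth_map_lift (M N : smoothQuotient R) (f : M -> N)
    (s : sq_total M -> sq_total N) :
  continuous s -> (forall x v e, s (rline x v e) = rline (s x) (s v) e) ->
  (forall u, @sq_dom R M u <-> @sq_dom R N (s u)) ->
  (forall u, @sq_dom R M u -> f (sq_proj u) = sq_proj (s u)) -> smooth_map f.
Proof.
move=> cs ls ds fs W oW.
have E : sq_preimage (f @^-1` W) = s @^-1` (sq_preimage W).
  rewrite /sq_preimage; apply/seteqP; split=> u /= [du].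
    by rewrite fs //; split=> //; apply/ds.
  by move=> Wu; split; [apply/ds|rewrite fs //; apply/ds].
have oW' : open (sq_preimage (f @^-1` W)).
  by rewrite E; apply: open_comp oW => x _; exact: cs.
split=> // h sh n; apply: (Cn_on_ext (f := (h \o @sq_proj R N) \o s)) => //.
  by move=> x [dx _] /=; rewrite fs.
by rewrite E; apply: Cn_on_comp => //; exact: sh.
Qed.

(** Besides the trivial equality, this says that the common derivative exists:
    in the total space the curve is a real line. *)
Lemma same_velocity_refl (M : smoothQuotient R) (q v : sq_total M) :
  @sq_dom R M q ->
  same_velocity (@sq_proj R M \o rline q v) (@sq_proj R M \o rline q v).
Proof.
move=> dq; split=> // W h oW; rewrite /= rline0 => Wq sh.
have [_ /(_ v)[dv _]] := sh 1%N.
by eexists; split; exact: derivableP (dv q (conj dq Wq)).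
Qed.

Section Quotient.
Variable V : normedModType C.
Variables a b : V -> C.
Hypotheses (ca : continuous a) (cb : continuous b).
Hypotheses (la : forall x v e, a (rline x v e) = a x + e%:C * a v)
  (lb : forall x v e, b (rline x v e) = b x + e%:C * b v).

(** [Re (a / b)] is [(Re a Re b + Im a Im b) / (Re b ^ 2 + Im b ^ 2)]; the identity
    also holds where [b] vanishes, since both sides are then [0]. *)
Lemma ratfun_Re_div (O : set V) : (forall x, O x -> b x != 0) ->
  ratfun O (fun x => complex.Re (a x / b x)).
Proof.
move=> nz; have rl (c : V -> C) (k : C -> R) : continuous k -> {morph k : x y / x + y} ->
    (forall (e : R) z, k (e%:C * z) = e * k z) -> continuous c ->
    (forall x v e, c (rline x v e) = c x + e%:C * c v) ->
    ratfun O (k \o c).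
  move=> ck kD kZ cc lc; apply: ratfun_lin => [|x v e] /=.
    by move=> x; exact: (continuous_comp (cc x) (@ck _)).
  by rewrite lc kD kZ.
have ReZ (e : R) z : complex.Re (e%:C * z) = e * complex.Re z.
  by case: z => x y /=; rewrite mul0r subr0.
have ImZ (e : R) z : complex.Im (e%:C * z) = e * complex.Im z.
  by case: z => x y /=; rewrite mul0r addr0.
have Re c := rl c _ Re_continuous (raddfD _) ReZ.
have Im c := rl c _ Im_continuous (raddfD _) ImZ.
have -> : (fun x => complex.Re (a x / b x)) = fun x =>
    (complex.Re (a x) * complex.Re (b x) + complex.Im (a x) * complex.Im (b x)) *
    (complex.Re (b x) * complex.Re (b x) + complex.Im (b x) * complex.Im (b x))^-1.
  apply/funext => x; case: (a x) (b x) => x1 x2 [y1 y2] /=.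
  by rewrite -!expr2; ring.
apply: ratfun_mul.
  by apply: ratfun_add; apply: ratfun_mul; [exact: Re|exact: Re|exact: Im|exact: Im].
apply: ratfun_inv => [|x /nz].
  by apply: ratfun_add; apply: ratfun_mul; [exact: Re|exact: Re|exact: Im|exact: Im].
case: (b x) => y1 y2 /=; apply: contra; rewrite -!expr2 paddr_eq0 ?sqr_ge0 //.
by rewrite !sqrf_eq0 => /andP[/eqP-> /eqP->].
Qed.
End Quotient.
End RealSmoothness.

(** * The Hermitian form and its tangent vectors *)

Section HermitianAlgebra.
Variable A : involRingType.
Implicit Types (a b : A) (u v w p q : A * A).

Lemma hermDl u v w : herm (u + v) w = herm u w + herm v w.
Proof. by rewrite /herm /=; ring. Qed.

Lemma herm_scall a u v : herm (scalv a u) v = a * herm u v.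
Proof. by rewrite /herm /=; ring. Qed.

Lemma herm_scal a u v : herm (scalv a u) (scalv a v) = (a * invol a) * herm u v.
Proof. by rewrite /herm /= !involM; ring. Qed.

(** The pairing [herm u p] is an explicit combination of the coordinates of [u]
    with coefficients from [p], so it generates the unit ideal when it is a unit. *)
Lemma good_herm u p : herm u p \is a GRing.unit -> good u.
Proof.
move=> U; apply: (@good_unit _ _ (- invol p.1 / herm u p) (invol p.2 / herm u p)).
by rewrite !mulrA -mulrDl mulrN -/(herm u p) divrr.
Qed.

Lemma good_scalv a u : a \is a GRing.unit -> good u -> good (scalv a u).
Proof.
move=> aU gu; have [x [y h]] := gu a^-1; apply: (@good_unit _ _ x y) => /=.
by rewrite -!mulrA -mulrDr h divrr.
Qed.

Lemma cls_scalv a u : a \is a GRing.unit -> good u -> cls (scalv a u) = cls u.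
Proof.
by move=> aU gu; symmetry; apply/cls_eqP => //; [exact: good_scalv|exists a].
Qed.

(** Every point of the line is a multiple of [q], so linearity propagates the
    value at [q]; the remaining fields are proofs. *)
Lemma tangent_ext q (s t : tangent q) : at_base s = at_base t -> s = t.
Proof.
have val_at (r : tangent q) a (x : {x | line q x}) :
    sval x = scalv a q -> r x = scalv a (at_base r).
  move=> xE; have := @tan_linear _ _ r a 0 (exist _ q (line_self q))
    (exist _ q (line_self q)) x.
  have s0 v : scalv 0 v = 0 by rewrite /scalv !mul0r.
  by rewrite /= !s0 !addr0; exact.
move=> st; have fE : tan_fun s = tan_fun t.
  apply/funext => x; have [a _ xE] := svalP x.
  by rewrite (val_at s a) // (val_at t a) // st.
case: s t fE {st val_at} => f lf pf [g lg pg] /= fg.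
by subst g; congr Tangent; exact: Prop_irrelevance.
Qed.

(** For [x] on the line of [q], the scalar [a] with [x = a q] is
    [herm x q / herm q q], so the map [a q |-> a v] is given by a formula that is
    visibly linear in [x]. *)
Lemma tangent_exists q v : herm q q \is a GRing.unit -> herm v q = 0 ->
  exists t : tangent q, at_base t = v.
Proof.
move=> U vq.
pose f (x : {x | line q x}) := scalv (herm (sval x) q / herm q q) v.
have lf a b (x y z : {x | line q x}) :
    sval z = scalv a (sval x) + scalv b (sval y) ->
    f z = scalv a (f x) + scalv b (f y).
  move=> zE; rewrite /f zE hermDl !herm_scall /scalv /=.
  by congr (_, _); rewrite /=; ring.
have pf x : herm (f x) q = 0 by rewrite herm_scall vq mulr0.
by exists (Tangent lf pf); rewrite /at_base /= /f /= divrr // scal1v.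
Qed.

End HermitianAlgebra.

(** * Lambda as a diffeomorphism *)

Section Projection.
Variable R : realType.
Local Notation C := R[i].
Local Notation F := (R[i] * R[i])%type.

Definition split_comp (u : F * F) : ((C * C) * (C * C))%type := (fstv u, sndv u).
Definition join_comp (u : (C * C) * (C * C)) : (F * F)%type :=
  ((u.1.1, u.2.1), (u.1.2, u.2.2)).

Lemma herm_fst (u v : F * F) : (herm u v).1 = herm (fstv u) (fstv v).
Proof. by []. Qed.

Lemma herm_snd (u v : F * F) : (herm u v).2 = herm (sndv u) (sndv v).
Proof. by []. Qed.

Lemma split_compK : cancel split_comp join_comp.
Proof. by case=> [[a b] [c d]]. Qed.
Lemma join_compK : cancel join_comp split_comp.
Proof. by case=> [[a b] [c d]]. Qed.

Lemma good_split (u : F * F) : good u <-> good (fstv u) /\ good (sndv u).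
Proof.
split=> [gu|[g1 g2]]; first by split; [exact: good_fstv|exact: good_sndv].
have [x1 [y1 h1]] := g1 1; have [x2 [y2 h2]] := g2 1.
by apply: (@good_unit _ _ (x1, x2) (y1, y2)); exact: (congr2 pair h1 h2).
Qed.

Lemma continuous_pair (S T1 T2 : topologicalType) (f : S -> T1) (g : S -> T2) :
  continuous f -> continuous g -> continuous (fun x => (f x, g x)).
Proof. by move=> cf cg x; apply: cvg_pair; [exact: cf|exact: cg]. Qed.

Lemma continuous_fst (S T1 T2 : topologicalType) (f : S -> (T1 * T2)%type) :
  continuous f -> continuous (fun x => (f x).1).
Proof. by move=> cf x; apply: (continuous_comp (cf x)); exact: cvg_fst. Qed.

Lemma continuous_snd (S T1 T2 : topologicalType) (f : S -> (T1 * T2)%type) :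
  continuous f -> continuous (fun x => (f x).2).
Proof. by move=> cf x; apply: (continuous_comp (cf x)); exact: cvg_snd. Qed.

Lemma split_comp_continuous : continuous split_comp.
Proof.
have i : continuous (fun u : F * F => u) by move=> u; exact: cvg_id.
have i1 := continuous_fst i; have i2 := continuous_snd i.
apply: continuous_pair; apply: continuous_pair.
- exact: (continuous_fst i1).
- exact: (continuous_fst i2).
- exact: (continuous_snd i1).
- exact: (continuous_snd i2).
Qed.

Lemma join_comp_continuous : continuous join_comp.
Proof.
have i : continuous (fun u : (C * C) * (C * C) => u) by move=> u; exact: cvg_id.
have i1 := continuous_fst i; have i2 := continuous_snd i.
apply: continuous_pair; apply: continuous_pair.
- exact: (continuous_fst i1).
- exact: (continuous_fst i2).
- exact: (continuous_snd i1).
- exact: (continuous_snd i2).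
Qed.

Lemma rline_pair (V W : normedModType C) (x v : V) (y w : W) e :
  rline (x, y) (v, w) e = (rline x v e, rline y w e).
Proof. by []. Qed.

Lemma fstv_rline (u v : F * F) e : fstv (rline u v e) = rline (fstv u) (fstv v) e.
Proof. by case: u v => [[a b] [c d]] [[a' b'] [c' d']]; rewrite !rline_pair. Qed.

Lemma sndv_rline (u v : F * F) e : sndv (rline u v e) = rline (sndv u) (sndv v) e.
Proof. by case: u v => [[a b] [c d]] [[a' b'] [c' d']]; rewrite !rline_pair. Qed.

Lemma split_comp_rline u v e :
  split_comp (rline u v e) = rline (split_comp u) (split_comp v) e.
Proof. by rewrite /split_comp rline_pair fstv_rline sndv_rline. Qed.

Lemma join_comp_rline u v e :
  join_comp (rline u v e) = rline (join_comp u) (join_comp v) e.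
Proof. by case: u v => [[a b] [c d]] [[a' b'] [c' d']]; rewrite !rline_pair. Qed.

Definition join_P1 (x : prodM (P1C R) (P1C R)) : P1F R :=
  cls (join_comp (rep x.1, rep x.2)).

Lemma join_P1E (u : (C * C) * (C * C)) : good u.1 -> good u.2 ->
  join_P1 (cls u.1, cls u.2) = cls (join_comp u).
Proof.
case: u => u v /= gu gv; have [c cU E] := rep_cls gu; have [d dU D] := rep_cls gv.
rewrite /join_P1 /= E D; symmetry; apply/cls_eqP.
- exact/good_split.
- by apply/good_split; split; rewrite /fstv /sndv /=; apply: good_scalv.
- by exists (c, d) => //; rewrite -[_ \is a _]/(_ && _) cU.
Qed.

(** [split_comp] is a linear homeomorphism matching the good vectors on both
    sides, and it covers [Lambda]; its inverse covers [join_P1]. *)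
Lemma Lambda_diffeo : diffeomorphism (@Lambda R).
Proof.
exists join_P1; split.
- move=> x; rewrite -(repK x) LambdaE; last exact: rep_good.
  have /good_split[g1 g2] := rep_good x.
  by rewrite (@join_P1E (split_comp _)) // split_compK.
- move=> [x y]; have g : good (join_comp (rep x, rep y)).
    by apply/good_split; split; exact: rep_good.
  have [E1 E2] := join_compK (rep x, rep y).
  by rewrite /join_P1 LambdaE //= E1 E2; exact: (congr2 pair (repK (x : P1 C)) (repK (y : P1 C))).
- apply: (@smooth_map_lift R (P1F R) (prodM (P1C R) (P1C R)) _ split_comp).
  + exact: split_comp_continuous.
  + exact: split_comp_rline.
  + exact: good_split.
  + exact: LambdaE.
- apply: (@smooth_map_lift R (prodM (P1C R) (P1C R)) (P1F R) _ join_comp).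
  + exact: join_comp_continuous.
  + exact: join_comp_rline.
  + by move=> u /=; split=> [h|/good_split h]; [apply/good_split|].
  + by move=> u [g1 g2]; exact: join_P1E.
Qed.

Lemma Lambda_B4 : @Lambda R @` @B4 R = @H1C R `*` @H1C R.
Proof.
apply/seteqP; split=> [_ [_ [u [gu [n1 n2]] <-] <-]|[x y] /= [[u [gu nu] <-] [v [gv nv] <-]]].
  have /good_split[g1 g2] := gu.
  by rewrite LambdaE //; split; [exists (fstv u)|exists (sndv u)].
have [E1 E2] := join_compK (u, v).
have g : good (join_comp (u, v)) by apply/good_split; rewrite E1 E2.
exists (cls (join_comp (u, v))); last by rewrite LambdaE // E1 E2.
by exists (join_comp (u, v)).
Qed.

(** * Velocities in a product of projective lines *)

Lemma invol_neq0 (c : C) : c != 0 -> invol c != 0.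
Proof. by apply: contra => /eqP h; rewrite -[c]involK h invol0. Qed.

Lemma herm_rline (p w v : C * C) e :
  herm (rline p w e) v = herm p v + e%:C * herm w v.
Proof. by rewrite /rline hermDl -herm_scall. Qed.

Lemma continuous_herm (V : normedModType C) (f : V -> (C * C)%type) (w : C * C) :
  continuous f -> continuous (fun x => herm (f x) w).
Proof.
move=> cf x; rewrite /herm.
apply: cvgD; first apply: cvgN.
  by apply: cvgMl; exact: (continuous_fst cf).
by apply: cvgMl; exact: (continuous_snd cf).
Qed.

(** The Boolean index lets one argument treat both factors of the bidisc; the type
    is a parameter because it applies both to vectors and to their classes. *)
Definition factor (b : bool) (T : Type) (u : T * T) : T := if b then u.1 else u.2.

Local Notation CC := ((C * C) * (C * C))%type.
Local Notation P1C2 := (prodM (P1C R) (P1C R)).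

Lemma open_neq0C (V : topologicalType) (f : V -> C) :
  continuous f -> open [set x | f x != 0].
Proof.
move=> cf; have -> : [set x | f x != 0] = f @^-1` (~` [set 0]).
  by apply/seteqP; split=> x /= /eqP.
apply: open_comp => [x _|]; first exact: cf.
rewrite openC; apply: accessible_closed_set1; apply: hausdorff_accessible.
exact: norm_hausdorff.
Qed.

Lemma open_goodC (V : topologicalType) (f : V -> (C * C)%type) :
  continuous f -> open [set x | good (f x)].
Proof.
move=> cf; have -> : [set x | good (f x)] =
    [set x | (f x).1 != 0] `|` [set x | (f x).2 != 0].
  apply/seteqP; split=> x /=; case: (f x) => [a b].
    by move=> /good_complexE; rewrite xpair_eqE negb_and => /orP.
  by move=> h; apply/good_complexE; rewrite xpair_eqE negb_and; apply/orP.
by apply: openU; apply: open_neq0C; [exact: (continuous_fst cf)|exact: (continuous_snd cf)].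
Qed.

Lemma factor_continuous b : continuous (fun u : CC => factor b u).
Proof.
have i : continuous (fun u : CC => u) by move=> u; exact: cvg_id.
by case: b; [exact: (continuous_fst i)|exact: (continuous_snd i)].
Qed.

Lemma open_dom_P1C2 : open (@sq_dom R P1C2).
Proof.
have -> : @sq_dom R P1C2 =
    [set u : CC | good (factor true u)] `&` [set u : CC | good (factor false u)] by [].
by apply: openI; apply: open_goodC; exact: factor_continuous.
Qed.

Lemma factor_rline b (x v : CC) e :
  factor b (rline x v e) = rline (factor b x) (factor b v) e.
Proof. by case: b. Qed.

Lemma herm_rep (u : C * C) : good u ->
  exists2 c : C, c != 0 & forall w, herm (rep (cls u)) w = c * herm u w.
Proof.
move=> gu; have [c cU E] := rep_cls gu; exists c; first by rewrite -unitfE.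
by move=> w; rewrite E herm_scall.
Qed.

Lemma herm_rep_ratio (u : C * C) w q : good u ->
  herm (rep (cls u)) w / herm (rep (cls u)) q = herm u w / herm u q.
Proof.
by move=> /herm_rep[c c0 E]; rewrite !E -mulf_div divff // mul1r.
Qed.

Lemma herm_rep_neq0 (u : C * C) q : good u ->
  (herm (rep (cls u)) q != 0) = (herm u q != 0).
Proof. by move=> /herm_rep[c c0 E]; rewrite E mulf_eq0 (negbTE c0). Qed.

Lemma good_factor b (u : CC) : @sq_dom R P1C2 u -> good (factor b u).
Proof. by case: b => -[]. Qed.

Lemma factor_sq_proj b (u : CC) :
  factor b (@sq_proj R P1C2 u : P1 C * P1 C) = cls (factor b u).
Proof. by case: b. Qed.

(** Test functions around the class of [q]: on the open set where [herm u q] does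
    not vanish, [Re (herm u w / herm u q)] is invariant under scaling of [u].  It is
    centred at [q] on purpose: along [q + e v] with [v] orthogonal to [q] the
    denominator is constant, hence the coordinate is affine in [e] and its
    derivative [Re (herm v w / herm q q)] is read off. *)
Section Velocity.
Variables (b : bool) (q : CC) (w : C * C).
Let chart : set P1C2 := [set x : P1 C * P1 C | herm (rep (factor b x)) (factor b q) != 0].
Let coordinate (x : P1C2) : R :=
  complex.Re (herm (rep (factor b (x : P1 C * P1 C))) w /
              herm (rep (factor b (x : P1 C * P1 C))) (factor b q)).

Lemma chartE (u : CC) : good (factor b u) ->
  chart (@sq_proj R P1C2 u) <-> herm (factor b u) (factor b q) != 0.
Proof. by move=> gu; rewrite /chart /= factor_sq_proj herm_rep_neq0. Qed.

Lemma preimage_chart :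
  sq_preimage chart = @sq_dom R P1C2 `&` [set u : CC | herm (factor b u) (factor b q) != 0].
Proof.
by apply/seteqP; split=> u [du h]; split=> //; apply/chartE => //; exact: good_factor.
Qed.

Lemma mopen_chart : mopen chart.
Proof.
rewrite /mopen preimage_chart; apply: openI; first exact: open_dom_P1C2.
by apply: open_neq0C; apply: continuous_herm; exact: factor_continuous.
Qed.

Lemma msmooth_coordinate : msmooth chart coordinate.
Proof.
have lh (z : C * C) (x v : CC) e : herm (factor b (rline x v e)) z =
    herm (factor b x) z + e%:C * herm (factor b v) z.
  by rewrite factor_rline herm_rline.
have ch (z : C * C) : continuous (fun u : CC => herm (factor b u) z).
  by apply: continuous_herm; exact: factor_continuous.
have oO := mopen_chart.
have := ratfun_Re_div (ch w) (ch (factor b q)) (lh w) (lh (factor b q)).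
move=> /(_ (sq_preimage chart)) rf n.
apply: (Cn_on_ext oO) (ratfun_smooth oO (rf _) n) => u.
  by move=> [du _]; rewrite /= /coordinate factor_sq_proj herm_rep_ratio //; exact: good_factor.
by rewrite preimage_chart => -[].
Qed.

Hypothesis nq : herm (factor b q) (factor b q) != 0.

Lemma coordinate_rline (v : CC) : herm (factor b v) (factor b q) = 0 ->
  coordinate \o (@sq_proj R P1C2 \o rline q v) = fun e =>
   complex.Re (herm (factor b q) w / herm (factor b q) (factor b q)) +
   e * complex.Re (herm (factor b v) w / herm (factor b q) (factor b q)).
Proof.
move=> vq; apply/funext => e.
have E : herm (factor b (rline q v e)) (factor b q) = herm (factor b q) (factor b q).
  by rewrite factor_rline herm_rline vq mulr0 addr0.
have g : good (factor b (rline q v e)) by apply: (@good_herm _ _ (factor b q)); rewrite E unitfE.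
have key (u : CC) : good (factor b u) -> coordinate (@sq_proj R P1C2 u) =
    complex.Re (herm (factor b u) w / herm (factor b u) (factor b q)).
  by move=> gu; rewrite /coordinate factor_sq_proj herm_rep_ratio.
apply: etrans (key (rline q v e) g) _; rewrite E factor_rline herm_rline.
rewrite mulrDl -mulrA raddfD /=; congr (_ + _).
by case: (_ / _) => x y /=; rewrite mul0r subr0.
Qed.

Lemma velocity_coordinate (v v' : CC) :
  herm (factor b v) (factor b q) = 0 -> herm (factor b v') (factor b q) = 0 ->
  same_velocity (@sq_proj R P1C2 \o rline q v) (@sq_proj R P1C2 \o rline q v') ->
  complex.Re (herm (factor b v) w / herm (factor b q) (factor b q)) =
  complex.Re (herm (factor b v') w / herm (factor b q) (factor b q)).
Proof.
move=> vq v'q [_ sv].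
have derivE (u : CC) d : herm (factor b u) (factor b q) = 0 ->
    is_derive (0 : R) 1 (coordinate \o (@sq_proj R P1C2 \o rline q u)) d ->
    complex.Re (herm (factor b u) w / herm (factor b q) (factor b q)) = d.
  move=> uq; rewrite coordinate_rline // => -[_ <-].
  by have [_ ->] := is_derive_affine
    (complex.Re (herm (factor b q) w / herm (factor b q) (factor b q)))
    (complex.Re (herm (factor b u) w / herm (factor b q) (factor b q))).
have Wq : chart ((@sq_proj R P1C2 \o rline q v) 0).
  have gq : good (factor b q) by apply: (@good_herm _ _ (factor b q)); rewrite unitfE.
  by rewrite /comp rline0; apply/chartE.
have [d [dv dv']] := sv chart coordinate mopen_chart Wq msmooth_coordinate.
by rewrite (derivE v d vq dv) (derivE v' d v'q dv').
Qed.

End Velocity.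

(** Reversing the first coordinate turns the indefinite form into the definite
    one, and the factor [invol N] compensates the denominator [N]. *)
Lemma herm_sign_flip (d : C * C) (N : C) : N != 0 ->
  herm d (scalv (invol N) (- d.1, d.2)) / N = d.1 * invol d.1 + d.2 * invol d.2.
Proof.
case: d => x y N0; rewrite /herm /= !involM !involK.
have -> : invol (- x) = - invol x by exact: raddfN.
by field.
Qed.

(** The chosen test vector [w] makes the derivatives of the coordinate along [v]
    and [v'] differ by the squared Euclidean norm of [v - v'] in the factor [b]. *)
Lemma velocity_inj (q v v' : CC) :
  (forall b, herm (factor b q) (factor b q) != 0) ->
  (forall b, herm (factor b v) (factor b q) = 0) ->
  (forall b, herm (factor b v') (factor b q) = 0) ->
  same_velocity (@sq_proj R P1C2 \o rline q v) (@sq_proj R P1C2 \o rline q v') ->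
  v = v'.
Proof.
move=> nq vq v'q sv.
suff E b : factor b v = factor b v'.
  have := E true; have := E false.
  by case: v v' {vq v'q sv E} => [v1 v2] [w1 w2]; rewrite /factor /= => -> ->.
set N := herm (factor b q) (factor b q).
set d := factor b v - factor b v'.
pose w := scalv (invol N) (- d.1, d.2).
have : complex.Re (herm d w / N) = 0.
  have dE : herm d w = herm (factor b v) w - herm (factor b v') w by rewrite /d /herm /=; ring.
  rewrite dE mulrBl raddfB /=.
  by rewrite (velocity_coordinate w (nq b) (vq b) (v'q b) sv) subrr.
rewrite herm_sign_flip ?nq //.
move: (factor b v) (factor b v') @d {w} => [v1 v2] [w1 w2] /= H.
suff [/eqP + /eqP] : v1 - w1 = 0 /\ v2 - w2 = 0.
  by rewrite !subr_eq0 => /eqP-> /eqP->.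
move: (v1 - w1) (v2 - w2) H => [a1 a2] [b1 b2] /=.
rewrite !mulrN !opprK -!expr2 => /eqP.
rewrite !paddr_eq0 ?addr_ge0 ?sqr_ge0 // !sqrf_eq0.
by move=> /andP[/andP[/eqP-> /eqP->] /andP[/eqP-> /eqP->]].
Qed.

End Projection.

(** * The differential of Lambda and the metrics *)

Section Differential.
Variable R : realType.
Local Notation C := R[i].
Local Notation F := (R[i] * R[i])%type.
Local Notation CC := ((C * C) * (C * C))%type.
Local Notation P1C2 := (prodM (P1C R) (P1C R)).

Lemma unit_pairE (x : F) : (x \is a GRing.unit) = (x.1 != 0) && (x.2 != 0).
Proof. by rewrite -[LHS]/(_ && _) !unitfE. Qed.

Lemma rline_scalv (c : C) (u v : C * C) e :
  rline (scalv c u) (scalv c v) e = scalv c (rline u v e).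
Proof.
by case: u v => u1 u2 [v1 v2]; congr (_, _); rewrite /= mulrDr; congr (_ + _);
  rewrite /GRing.scale /= mulrCA.
Qed.

Section AtPoint.
Variables (p : F * F) (q1 q2 : C * C) (c1 c2 : C).
Hypotheses (np : negF p) (c10 : c1 != 0) (c20 : c2 != 0).
Hypotheses (q1E : q1 = scalv c1 (fstv p)) (q2E : q2 = scalv c2 (sndv p)).

Lemma herm_unit : herm p p \is a GRing.unit.
Proof. by case: np => n1 n2; rewrite unit_pairE !lt_eqF. Qed.

(** Rescaling multiplies [herm] by a nonzero factor, so representatives other than
    the components of [p] itself are still anisotropic. *)
Lemma herm_neq0 b : herm (factor b (q1, q2)) (factor b (q1, q2)) != 0.
Proof.
case: np => n1 n2; case: b; rewrite /factor /= ?q1E ?q2E herm_scal;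
  by rewrite !mulf_neq0 ?invol_neq0 // -?herm_fst -?herm_snd lt_eqF.
Qed.

(** The lift of the image of [t] to the representatives [q1], [q2]: changing the
    representative from [p] to [c p] multiplies the velocity by the same [c]. *)
Definition dvec (t : tangent p) : CC :=
  (scalv c1 (fstv (at_base t)), scalv c2 (sndv (at_base t))).

(** The equality holds for all [e], not only near [0]: as [at_base t] is orthogonal
    to [p], the pairing of [p + e t(p)] with [p] stays equal to [herm p p], so the
    vector never leaves the good ones. *)
Lemma Lambda_curve (t : tangent p) :
  @Lambda R \o curveF t = (@sq_proj R P1C2 \o rline (q1, q2) (dvec t)) :> (R -> P1C2).
Proof.
apply/funext => e.
have tp : herm (at_base t) p = 0 by exact: tan_perp.
have g : good (rline p (at_base t) e).
  apply: (@good_herm _ _ p).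
  suff -> : herm (rline p (at_base t) e) p = herm p p by exact: herm_unit.
  have -> : rline p (at_base t) e = p + scalv (e%:C, e%:C) (at_base t) by [].
  by rewrite hermDl herm_scall tp mulr0 addr0.
have [g1 g2] : good (fstv (rline p (at_base t) e)) /\ good (sndv (rline p (at_base t) e)).
  exact/good_split.
have E1 := fstv_rline p (at_base t) e; have E2 := sndv_rline p (at_base t) e.
have L : Lambda (cls (rline p (at_base t) e)) =
    (cls (fstv (rline p (at_base t) e)), cls (sndv (rline p (at_base t) e))).
  exact: LambdaE.
have S (c : C) (u v r : C * C) : c != 0 -> good r -> r = rline u v e ->
    cls r = cls (rline (scalv c u) (scalv c v) e).
  by move=> c0 gr rE; rewrite rline_scalv -rE cls_scalv // unitfE.
apply: etrans L _.
apply: etrans (congr2 pair (S c1 (fstv p) (fstv (at_base t)) _ c10 g1 E1)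
  (S c2 (sndv p) (sndv (at_base t)) _ c20 g2 E2)) _.
by rewrite -q1E -q2E.
Qed.

Lemma dvec_perp t b : herm (factor b (dvec t)) (factor b (q1, q2)) = 0.
Proof.
have tp : herm (at_base t) p = 0 by exact: tan_perp.
case: b; rewrite /factor /= ?q1E ?q2E herm_scal.
  by rewrite -herm_fst tp mulr0.
by rewrite -herm_snd tp mulr0.
Qed.

(** Both curves in the definition of [dLambda] are projected lines through
    [(q1, q2)] with orthogonal directions, and such directions are determined by
    the velocity. *)
Lemma dLambdaP (t : tangent p) (s : tangent q1 * tangent q2) :
  dLambda t s <-> (at_base s.1, at_base s.2) = dvec t.
Proof.
have sE : (fun e => (curveC s.1 e, curveC s.2 e)) =
  (@sq_proj R P1C2 \o rline (q1, q2) (at_base s.1, at_base s.2)) :> (R -> P1C2) by [].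
rewrite /dLambda Lambda_curve sE; split=> [sv|->].
  symmetry; apply: velocity_inj sv => // b; first exact: herm_neq0.
    exact: dvec_perp.
  by case: b; exact: tan_perp.
apply: same_velocity_refl; split.
  by apply: (@good_herm _ _ q1); rewrite unitfE; exact: (herm_neq0 true).
by apply: (@good_herm _ _ q2); rewrite unitfE; exact: (herm_neq0 false).
Qed.

Lemma dLambda_exists_unique (t : tangent p) :
  exists! s : tangent q1 * tangent q2, dLambda t s.
Proof.
have [s1 E1] := tangent_exists (etrans (unitfE _) (herm_neq0 true)) (dvec_perp t true).
have [s2 E2] := tangent_exists (etrans (unitfE _) (herm_neq0 false)) (dvec_perp t false).
exists (s1, s2); split=> [|[r1 r2] /dLambdaP [F1 F2]].
  by apply/dLambdaP; rewrite /= E1 E2.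
by congr (_, _); apply: tangent_ext; rewrite ?E1 ?E2 ?F1 ?F2.
Qed.

Lemma div_pairE (x y : F) : y \is a GRing.unit -> x / y = (x.1 / y.1, x.2 / y.2).
Proof.
move=> yU; apply: (mulIr yU); rewrite divrK //.
move: yU; rewrite unit_pairE => /andP[y1 y2].
by rewrite -[RHS]/(_ / _ * _, _ / _ * _) !divfK //; case: x.
Qed.

(** The metric is a quotient of two values of [herm], in which the scalars [c1] and
    [c2] cancel. *)
Lemma dLambda_isometry (t t' : tangent p) (s s' : tangent q1 * tangent q2) :
  dLambda t s -> dLambda t' s' -> gB4 t t' = gprod s s'.
Proof.
move=> /dLambdaP [E1 E2] /dLambdaP [E1' E2'].
have scale (c : C) (w w' r : C * C) : c != 0 ->
    herm (scalv c w) (scalv c w') / herm (scalv c r) (scalv c r) = herm w w' / herm r r.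
  by move=> c0; rewrite !herm_scal -mulf_div divff ?mul1r // mulf_neq0 ?invol_neq0.
rewrite /gB4 /gprod /gH1C /hmetric (div_pairE _ herm_unit) E1 E2 E1' E2'.
rewrite /= -?herm_fst -?herm_snd.
by congr (complex.Re (- _) + complex.Re (- _)); rewrite ?q1E ?q2E scale.
Qed.
End AtPoint.

Lemma Lambda_isometry (p : F * F) (q1 q2 : C * C) :
  good p -> negF p -> good q1 -> good q2 -> Lambda (cls p) = (cls q1, cls q2) ->
  (forall t : tangent p, exists! s : tangent q1 * tangent q2, dLambda t s) /\
  (forall (t t' : tangent p) (s s' : tangent q1 * tangent q2),
     dLambda t s -> dLambda t' s' -> gB4 t t' = gprod s s').
Proof.
move=> gp np g1 g2; rewrite LambdaE // => -[].
have /good_split[gp1 gp2] := gp.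
move=> /(cls_eqP gp1 g1)[c1 + E1] /(cls_eqP gp2 g2)[c2 + E2].
rewrite !unitfE => c10 c20.
split=> [t|t t' s s']; first exact: (dLambda_exists_unique np c10 c20).
exact: (dLambda_isometry np c10 c20).
Qed.
End Differential.

(** * The unitary groups *)

Section Groups.
Variable R : realType.
Local Notation C := R[i].
Local Notation F := (R[i] * R[i])%type.

Lemma fstv_mxact (T : 'M[F]_2) u : fstv (mxact T u) = mxact (map_mx fst T) (fstv u).
Proof. by rewrite /mxact !mxE. Qed.

Lemma sndv_mxact (T : 'M[F]_2) u : sndv (mxact T u) = mxact (map_mx snd T) (sndv u).
Proof. by rewrite /mxact !mxE. Qed.

(** The coordinates of [herm u v] only involve the corresponding components, and
    every vector is a component of some vector over the product ring. *)
Lemma unitary_split (T : 'M[F]_2) :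
  unitary T = unitary (map_mx fst T : 'M[C]_2) && unitary (map_mx snd T : 'M[C]_2).
Proof.
apply/asboolP/andP => [h|[/asboolP h1 /asboolP h2] u v].
  split; apply/asboolP => u v.
    have [Eu _] := join_compK (u, u); have [Ev _] := join_compK (v, v).
    have := congr1 fst (h (join_comp (u, u)) (join_comp (v, v))).
    by rewrite !herm_fst !fstv_mxact Eu Ev.
  have [_ Eu] := join_compK (u, u); have [_ Ev] := join_compK (v, v).
  have := congr1 snd (h (join_comp (u, u)) (join_comp (v, v))).
  by rewrite !herm_snd !sndv_mxact Eu Ev.
have := h1 (fstv u) (fstv v); have := h2 (sndv u) (sndv v).
rewrite -!fstv_mxact -!sndv_mxact => E2 E1.
rewrite -!herm_fst in E1; rewrite -!herm_snd in E2.
by rewrite [LHS]surjective_pairing [RHS]surjective_pairing E1 E2.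
Qed.

Definition pair_mx (S T : 'M[C]_2) : 'M[F]_2 := \matrix_(i, j) (S i j, T i j).

Lemma pair_mx_fst S T : map_mx fst (pair_mx S T) = S.
Proof. by apply/matrixP => i j; rewrite !mxE. Qed.

Lemma pair_mx_snd S T : map_mx snd (pair_mx S T) = T.
Proof. by apply/matrixP => i j; rewrite !mxE. Qed.

Lemma pair_mxK T : pair_mx (map_mx fst T) (map_mx snd T) = T.
Proof. by apply/matrixP => i j; rewrite !mxE; case: (T i j). Qed.

Lemma U_fst_proof (T : U F) : unitary (map_mx fst T : 'M[C]_2).
Proof. by have := U_unitary T; rewrite unitary_split => /andP[]. Qed.

Lemma U_snd_proof (T : U F) : unitary (map_mx snd T : 'M[C]_2).
Proof. by have := U_unitary T; rewrite unitary_split => /andP[]. Qed.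

Definition U_split (T : U F) : (U C * U C)%type :=
  (MkU (U_fst_proof T), MkU (U_snd_proof T)).

Lemma U_join_proof (x : (U C * U C)%type) : unitary (pair_mx x.1 x.2).
Proof. by rewrite unitary_split pair_mx_fst pair_mx_snd !U_unitary. Qed.

Definition U_join (x : (U C * U C)%type) : U F := MkU (U_join_proof x).

Lemma U_splitK : cancel U_split U_join.
Proof. by move=> T; apply/val_inj; rewrite /= pair_mxK. Qed.

Lemma U_joinK : cancel U_join U_split.
Proof.
by move=> [S T]; congr (_, _); apply/val_inj; rewrite /= ?pair_mx_fst ?pair_mx_snd.
Qed.

Lemma U_splitM : {morph U_split : S T / (S * T)%g}.
Proof.
move=> S T; congr (_, _); apply/val_inj => /=; exact: map_mxM.
Qed.
HB.instance Definition _ := isMultiplicative.Build (U F) (U C * U C)%type U_split U_splitM.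

Lemma Lambda_act (T : U F) (x : P1F R) : B4 x ->
  B4 (act T x) /\
  Lambda (act T x) = (act (U_split T).1 (Lambda x).1, act (U_split T).2 (Lambda x).2).
Proof.
move=> [u [gu nu] uE]; have TU := unitary_unitmx (U_unitary T).
have gTu := good_mxact TU gu; have /good_split[g1 g2] := gu.
have actx : act T x = cls (mxact T u) by rewrite -uE; exact: actE.
split.
  exists (mxact T u); last exact: esym actx.
  by split; [exact: gTu|have /asboolP h := U_unitary T; rewrite /negF h].
have Lx : Lambda x = (cls (fstv u), cls (sndv u)) by rewrite -uE; exact: LambdaE.
have LTx : Lambda (act T x) = (cls (fstv (mxact T u)), cls (sndv (mxact T u))).
  by rewrite actx; exact: LambdaE.
have T1 := unitary_unitmx (U_fst_proof T); have T2 := unitary_unitmx (U_snd_proof T).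
apply: etrans LTx _; rewrite fstv_mxact sndv_mxact -(actE T1 g1) -(actE T2 g2).
exact: (congr1 (fun y : P1 C * P1 C => (act _ y.1, act _ y.2)) (esym Lx)).
Qed.

Lemma special_split (T : U F) :
  special T = special (U_split T).1 && special (U_split T).2.
Proof.
rewrite /special /= !det_map_mx.
by case: (\det T) => a b; rewrite xpair_eqE.
Qed.

Lemma SU_fst_proof (T : SU F) : special (U_split T).1.
Proof. by have := SU_special T; rewrite special_split => /andP[]. Qed.

Lemma SU_snd_proof (T : SU F) : special (U_split T).2.
Proof. by have := SU_special T; rewrite special_split => /andP[]. Qed.

Definition SU_split (T : SU F) : (SU C * SU C)%type :=
  (MkSU (SU_fst_proof T), MkSU (SU_snd_proof T)).

Lemma SU_join_proof (x : (SU C * SU C)%type) :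
  special (U_join (U_of_SU x.1, U_of_SU x.2)).
Proof. by rewrite special_split U_joinK !SU_special. Qed.

Definition SU_join (x : (SU C * SU C)%type) : SU F := MkSU (SU_join_proof x).

Lemma SU_split_bij : bijective SU_split.
Proof.
exists SU_join => [T|[S T]].
  by apply/val_inj; rewrite /= -[RHS]U_splitK.
have [E1 E2] := U_joinK (U_of_SU S, U_of_SU T).
by congr (_, _); apply/val_inj; [exact: E1|exact: E2].
Qed.

Lemma SU_splitM : {morph SU_split : S T / (S * T)%g}.
Proof.
move=> S T; have [E1 E2] := U_splitM S T.
by congr (_, _); apply/val_inj; apply/val_inj; [exact: E1|exact: E2].
Qed.
HB.instance Definition _ :=
  isMultiplicative.Build (SU F) (SU C * SU C)%type SU_split SU_splitM.

(** Two scalar matrices, over the two factors, assemble into a single scalar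
    matrix over the product: this is what makes the projective groups split. *)
Lemma scalar_split (Z : U F) : is_scalar_mx Z <->
  is_scalar_mx (U_split Z).1 /\ is_scalar_mx (U_split Z).2.
Proof.
split=> [/is_scalar_mxP[a Za]|[/is_scalar_mxP[a Za] /is_scalar_mxP[b Zb]]].
  by split; apply/is_scalar_mxP; [exists a.1|exists a.2]; rewrite /= Za map_scalar_mx.
apply/is_scalar_mxP; exists (a, b); rewrite -(pair_mxK Z).
move: Za Zb => /= -> ->; apply/matrixP => i j; rewrite !mxE.
by case: (i == j).
Qed.

Lemma PU_of_eq (A : involRingType) (S T : U A) :
  PU_of S = PU_of T <-> exists2 Z : U A, is_scalar_mx Z & S = (Z * T)%g.
Proof.
by split=> [/eqmodP/asboolP|h]; last apply/eqmodP/asboolP.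
Qed.

Lemma PU_split_eq (S T : U F) : PU_of S = PU_of T <->
  PU_of (U_split S).1 = PU_of (U_split T).1 /\ PU_of (U_split S).2 = PU_of (U_split T).2.
Proof.
rewrite !PU_of_eq; split=> [[Z /scalar_split[Z1 Z2] ->]|[[Y Ys EY] [Z Zs EZ]]].
  by split; [exists (U_split Z).1|exists (U_split Z).2]; rewrite // U_splitM.
exists (U_join (Y, Z)); first by apply/scalar_split; rewrite U_joinK.
apply: (can_inj U_splitK); rewrite U_splitM U_joinK.
by rewrite [LHS]surjective_pairing EY EZ.
Qed.

Definition PU_split (x : PU F) : (PU C * PU C)%type :=
  (PU_of (U_split (repr x)).1, PU_of (U_split (repr x)).2).

Lemma PU_splitE (T : U F) :
  PU_split (PU_of T) = (PU_of (U_split T).1, PU_of (U_split T).2).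
Proof.
have /PU_split_eq[E1 E2] : PU_of (repr (PU_of T)) = PU_of T by exact: PU_ofP.
by rewrite /PU_split E1 E2.
Qed.

Definition PU_join (x : (PU C * PU C)%type) : PU F :=
  PU_of (U_join (repr x.1, repr x.2)).

Lemma PU_split_bij : bijective PU_split.
Proof.
exists PU_join => [x|[x y]].
  rewrite -[RHS]PU_ofP; apply/PU_split_eq; rewrite U_joinK.
  by split; exact: PU_ofP.
by rewrite /PU_join PU_splitE U_joinK /= !PU_ofP.
Qed.

Lemma PU_splitM : {morph PU_split : x y / (x * y)%g}.
Proof.
move=> x y; rewrite -(PU_ofP x) -(PU_ofP y).
have -> : (PU_of (repr x) * PU_of (repr y))%g = PU_of (repr x * repr y)%g.
  exact: PU_ofM.
rewrite !PU_splitE U_splitM.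
by apply: congr2; symmetry; exact: PU_ofM.
Qed.
HB.instance Definition _ :=
  isMultiplicative.Build (PU F) (PU C * PU C)%type PU_split PU_splitM.
End Groups.

Theorem mainTheorem4 (R : realType) :
  let C := R[i] in
  let F := (R[i] * R[i])%type in
  [/\ diffeomorphism (@Lambda R),
      @Lambda R @` @B4 R = @H1C R `*` @H1C R,
      (forall (p : F * F) (q1 q2 : C * C),
        good p -> negF p -> good q1 -> good q2 ->
        Lambda (cls p) = (cls q1, cls q2) ->
        (forall t : tangent p,
           exists! s : tangent q1 * tangent q2, dLambda t s) /\
        (forall (t t' : tangent p) (s s' : tangent q1 * tangent q2),
           dLambda t s -> dLambda t' s' -> gB4 t t' = gprod s s')) &
      exists2 f : {multiplicative U F -> (U C * U C)%type},
        [/\ bijective f,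
            (forall T : U F, mx_of_U (f T).1 = map_mx fst T /\
                             mx_of_U (f T).2 = map_mx snd T) &
            (forall (T : U F) (x : P1F R), @B4 R x ->
               @B4 R (act T x) /\
               Lambda (act T x) =
                 (act (f T).1 (Lambda x).1, act (f T).2 (Lambda x).2))] &
        (exists2 fS : {multiplicative SU F -> (SU C * SU C)%type},
           bijective fS &
           forall T : SU F, (U_of_SU (fS T).1, U_of_SU (fS T).2) = f T) /\
        (exists2 fP : {multiplicative PU F -> (PU C * PU C)%type},
           bijective fP &
           forall T : U F, fP (PU_of T) = (PU_of (f T).1, PU_of (f T).2))].
Proof.
move=> C F; split.
- exact: Lambda_diffeo.
- exact: Lambda_B4.
- exact: Lambda_isometry.
exists (@U_split R : {multiplicative U F -> (U C * U C)%type}).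
  split=> //; last exact: Lambda_act.
  by exists (@U_join R); [exact: U_splitK|exact: U_joinK].
split.
  exists (@SU_split R : {multiplicative SU F -> (SU C * SU C)%type}) => //.
  exact: SU_split_bij.
exists (@PU_split R : {multiplicative PU F -> (PU C * PU C)%type}).
  exact: PU_split_bij.
exact: PU_splitE.
Qed.
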